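(* Let $0<s_2<s_1<1<q<p<\infty$, let $\Omega\subset\mathbb{R}^d$ be a bounded open set and let $\alpha,\beta\in\mathbb{R}$. Assume that $u\in W_0^{s_1,p}(\Omega)$ is a nonnegative (weak) solution of $$(-\Delta)^{s_1}_pu+(-\Delta)^{s_2}_qu=\alpha|u|^{p-2}u+\beta|u|^{q-2}u\ \text{ in }\Omega,\qquad u=0\ \text{ in }\mathbb{R}^d\setminus\Omega.$$ Then $u\in L^\infty(\mathbb{R}^d)$.
   Context: For $0<s<1<r<\infty$ let $[u]_{s,r}=\Big(\iint_{\mathbb{R}^d\times\mathbb{R}^d}\frac{|u(x)-u(y)|^r}{|x-y|^{d+sr}}\,dx\,dy\Big)^{1/r}$ and $W_0^{s,r}(\Omega)=\{u\in L^r(\mathbb{R}^d): [u]_{s,r}<\infty,\ u=0 \text{ in }\mathbb{R}^d\setminus\Omega\}$, normed by $[\cdot]_{s,r}$. Under $s_2<s_1$, $q<p$ one has $W_0^{s_1,p}(\Omega)\hookrightarrow W_0^{s_2,q}(\Omega)$. A (weak) solution is $u\in W_0^{s_1,p}(\Omega)$ such that for all $\phi\in W_0^{s_1,p}(\Omega)$ $$\iint_{\mathbb{R}^d\times\mathbb{R}^d}\tfrac{|u(x)-u(y)|^{p-2}(u(x)-u(y))(\phi(x)-\phi(y))}{|x-y|^{d+s_1p}}dxdy+\iint_{\mathbb{R}^d\times\mathbb{R}^d}\tfrac{|u(x)-u(y)|^{q-2}(u(x)-u(y))(\phi(x)-\phi(y))}{|x-y|^{d+s_2q}}dxdy=\alpha\int_\Omega|u|^{p-2}u\phi\,dx+\beta\int_\Omega|u|^{q-2}u\phi\,dx.$$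 *)

(* Defs.v *)
From HB Require Import structures.
From mathcomp Require Import all_boot all_order all_algebra.
From mathcomp Require Import all_classical all_reals all_analysis.
Set Implicit Arguments.
Unset Strict Implicit.
Unset Printing Implicit Defensive.
Import Order.TTheory GRing.Theory Num.Theory.
Import numFieldNormedType.Exports.
Local Open Scope classical_set_scope.
Local Open Scope ring_scope.

(* R^n is 'rV[R]_n, with the topology and boundedness of the library (sup norm)
   and the product sigma-algebra, as for n.-tuple T; for T = R this is the
   Borel sigma-algebra. *)
Section measurable_rV.
Context {d} {T : sigmaRingType d} (n : nat).

Let coord_rV (i : 'I_n) (x : 'rV[T]_n) : T := x ord0 i.

Let rV_set0 : g_sigma_preimage coord_rV set0.
Proof. exact: sigma_algebra0. Qed.

Let rV_setC A : g_sigma_preimage coord_rV A -> g_sigma_preimage coord_rV (~` A).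
Proof. exact: sigma_algebraC. Qed.

Let rV_bigcup (F : (set 'rV[T]_n)^nat) :
  (forall i, g_sigma_preimage coord_rV (F i)) ->
  g_sigma_preimage coord_rV (\bigcup_i (F i)).
Proof. exact: sigma_algebra_bigcup. Qed.

HB.instance Definition _ := @isMeasurable.Build (measure_tuple_display d)
  'rV[T]_n (g_sigma_preimage coord_rV) rV_set0 rV_setC rV_bigcup.

End measurable_rV.

Lemma measurable_coord_rV d (T : sigmaRingType d) n (i : 'I_n) :
  measurable_fun [set: 'rV[T]_n] (fun x => x ord0 i).
Proof.
move=> _ Y mY; rewrite setTI; apply: sub_sigma_algebra => /=.
rewrite -bigcup_seq/=; exists i => /=; first by rewrite mem_index_enum.
by exists Y => //; rewrite setTI.
Qed.

Lemma measurable_fun_rVP d1 d2 (T1 : measurableType d1) (T2 : measurableType d2)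
    n (f : T1 -> 'rV[T2]_n) :
  measurable_fun [set: T1] f <->
  forall i, measurable_fun [set: T1] (fun x => f x ord0 i).
Proof.
split=> [mf i|mf].
  exact: (measurableT_comp (@measurable_coord_rV _ T2 n i)).
move=> _ A; rewrite setTI; move: A; apply: smallest_sub.
  split=> [|A mA|F mF].
  - by rewrite /= preimage_set0.
  - by rewrite /= setTD preimage_setC; exact: measurableC.
  - by rewrite /= preimage_bigcup; exact: bigcup_measurable.
rewrite -bigcup_seq/=; apply: bigcup_sub => i _ A [B mB <-].
rewrite /= setTI -[X in measurable X]setTI; exact: mf.
Qed.

Section lebesgue_rV.
Context {R : realType}.
Local Open Scope ereal_scope.

Definition cons_rV n (z : R * 'rV[R]_n) : 'rV[R]_n.+1 :=
  \row_i oapp (z.2 ord0) z.1 (unlift ord0 i).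

Lemma cons_rV0 n (z : R * 'rV[R]_n) : cons_rV z ord0 ord0 = z.1.
Proof. by rewrite mxE unlift_none. Qed.

Lemma cons_rVS n (z : R * 'rV[R]_n) j : cons_rV z ord0 (lift ord0 j) = z.2 ord0 j.
Proof. by rewrite mxE liftK. Qed.

Lemma measurable_cons_rV n : measurable_fun setT (@cons_rV n).
Proof.
apply/measurable_fun_rVP => i; case: (unliftP ord0 i) => [j|] ->.
  under eq_fun do rewrite cons_rVS.
  exact: (measurableT_comp (measurable_coord_rV j) measurable_snd).
under eq_fun do rewrite cons_rV0.
exact: measurable_fst.
Qed.

Definition uncons_rV n (x : 'rV[R]_n.+1) : R * 'rV[R]_n :=
  (x ord0 ord0, \row_j x ord0 (lift ord0 j)).

Lemma cons_rVK n : cancel (@cons_rV n) (@uncons_rV n).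
Proof.
move=> [a x]; rewrite /uncons_rV cons_rV0; congr pair.
by apply/rowP => j; rewrite mxE cons_rVS.
Qed.

Lemma measurable_uncons_rV n : measurable_fun setT (@uncons_rV n).
Proof.
apply/measurable_fun_pairP; split; first exact: measurable_coord_rV.
apply/measurable_fun_rVP => i.
under eq_fun do rewrite /= mxE.
exact: measurable_coord_rV.
Qed.

(* Lebesgue measure on R^n: the image of the product of n copies of Lebesgue
   measure on R; see lebesgue_rV_box. *)
Fixpoint lebesgue_rV n : set 'rV[R]_n -> \bar R :=
  match n with
  | 0%N => \d_(0%R : 'rV[R]_0)
  | n'.+1 =>
      pushforward (@lebesgue_measure R \x @lebesgue_rV n') (@cons_rV n')
  end.

(* The library's canonical sigma-finite instance for m1 \x m2 only covers
   subprobability measures, so the inductive step is proved by hand. *)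
Section sigma_finite_pack.
Context d (T : measurableType d) (m : {measure set T -> \bar R}).

Definition sigma_finite_pack of sigma_finite setT m : set T -> \bar R := m.

Hypothesis sf : sigma_finite setT m.

HB.instance Definition _ := Measure.copy (sigma_finite_pack sf) m.
HB.instance Definition _ :=
  Measure_isSigmaFinite.Build _ _ _ (sigma_finite_pack sf) sf.

End sigma_finite_pack.

Let lebesgue_rV_spec n :
  {mu : {sigma_finite_measure set 'rV[R]_n -> \bar R} | mu = @lebesgue_rV n :> (_ -> _)}.
Proof.
elim: n => [|n [mu IH]]; first by exists (\d_(0%R : 'rV[R]_0)).
pose nu := pushforward (@lebesgue_measure R \x mu) (@cons_rV n).
pose nuM : {measure set 'rV[R]_n.+1 -> \bar R} :=
  measure_function_pushforward__canonical__measure_function_Measure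
    (@lebesgue_measure R \x mu) (@measurable_cons_rV n).
have nu_sf : sigma_finite setT nu.
  have /sigma_finiteP[F [TF ndF Foo]] := sigma_finiteT (@lebesgue_measure R).
  have /sigma_finiteP[G [TG ndG Goo]] := sigma_finiteT mu.
  exists (fun k => @uncons_rV n @^-1` (F k `*` G k)).
    apply/esym; rewrite -subTset => x _.
    have [k _ Fk] : (\bigcup_k F k) (uncons_rV x).1 by rewrite -TF.
    have [l _ Gl] : (\bigcup_k G k) (uncons_rV x).2 by rewrite -TG.
    exists (maxn k l) => //; split.
    - by move: Fk; exact/subsetPset/ndF/leq_maxl.
    - by move: Gl; exact/subsetPset/ndG/leq_maxr.
  move=> k; have [mF Fk] := Foo k; have [mG Gk] := Goo k.
  have mFG : measurable (F k `*` G k) by exact: measurableX.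
  split.
    by rewrite -[X in measurable X]setTI; exact: measurable_uncons_rV.
  rewrite /nu /pushforward -comp_preimage (_ : _ \o _ = id); last first.
    by apply/funext => z; exact: cons_rVK.
  rewrite preimage_id product_measure1E//.
  by rewrite lte_mul_pinfty// ge0_fin_numE.
by exists (sigma_finite_pack (m := nuM) nu_sf); rewrite /= -IH.
Qed.

Let lebesgue_rV0 n : @lebesgue_rV n set0 = 0.
Proof. by have [mu <-] := lebesgue_rV_spec n. Qed.

Let lebesgue_rV_ge0 n A : 0 <= @lebesgue_rV n A.
Proof. by have [mu <-] := lebesgue_rV_spec n. Qed.

Let lebesgue_rV_sigma_additive n : semi_sigma_additive (@lebesgue_rV n).
Proof.
by have [mu <-] := lebesgue_rV_spec n; exact: measure_semi_sigma_additive.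
Qed.

Let lebesgue_rV_sigma_finite n : sigma_finite setT (@lebesgue_rV n).
Proof. by have [mu <-] := lebesgue_rV_spec n; exact: sigma_finiteT. Qed.

HB.instance Definition _ n := isMeasure.Build _ _ _ (@lebesgue_rV n)
  (@lebesgue_rV0 n) (@lebesgue_rV_ge0 n) (@lebesgue_rV_sigma_additive n).

HB.instance Definition _ n := Measure_isSigmaFinite.Build _ _ _
  (@lebesgue_rV n) (@lebesgue_rV_sigma_finite n).

Lemma lebesgue_rV_box n (A : 'I_n -> set R) : (forall i, measurable (A i)) ->
  lebesgue_rV [set x : 'rV[R]_n | forall i, A i (x ord0 i)] =
  \prod_(i < n) lebesgue_measure (A i).
Proof.
elim: n A => [|n IH] A mA.
  by rewrite big_ord0 /= diracE mem_set// => -[].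
have mB : measurable [set x : 'rV[R]_n | forall j, A (lift ord0 j) (x ord0 j)].
  rewrite (_ : mkset _ = \bigcap_(j in [set` 'I_n])
      ((fun x : 'rV[R]_n => x ord0 j) @^-1` A (lift ord0 j))); last first.
    by apply/seteqP; split => x /= Ax j; [move=> _|]; exact: Ax.
  apply: fin_bigcap_measurable => //= j _.
  by rewrite -[X in measurable X]setTI; exact: measurable_coord_rV.
rewrite big_ord_recl -IH//= /pushforward.
rewrite -product_measure1E//; last exact: mA.
congr (product_measure1 _ _ _).
apply/seteqP; split => [[a x] /= Ax|[a x] /= [Aa Ax] i].
  split; first by have := Ax ord0; rewrite cons_rV0.
  by move=> j; have := Ax (lift ord0 j); rewrite cons_rVS.
by case: (unliftP ord0 i) => [j|] ->; rewrite ?cons_rVS ?cons_rV0.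
Qed.

End lebesgue_rV.
Arguments lebesgue_rV {R} n _.

Section fractional_sobolev.
Context {R : realType} {d : nat}.
Implicit Types (s r : R) (u phi : 'rV[R]_d -> R) (Omega : set 'rV[R]_d).

(* |x - y| in the kernels is Euclidean; the library norm on 'rV[R]_d is the sup
   norm. *)
Definition l2norm (x : 'rV[R]_d) : R := Num.sqrt (\sum_i x ord0 i ^+ 2).

Local Notation leb := (lebesgue_rV d).

Definition gagliardo s r u : \bar R :=
  ((\int[(leb \x leb)%E]_z
     (`|u z.1 - u z.2| `^ r / l2norm (z.1 - z.2) `^ (d%:R + s * r))%:E)
   `^ r^-1)%E.

(* W_0^{s,r}(Omega), without the quotient by a.e. equality. *)
Definition W0 s r Omega : set ('rV[R]_d -> R) :=
  [set u | [/\ u \in Lfun leb r%:E, (gagliardo s r u < +oo)%E &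
             {ae leb, forall x, ~ Omega x -> u x = 0}]].

(* |a|^(r-2) a, which is 0 at a = 0 even for r < 2, since powR is total. *)
Definition signed_pow r (a : R) : R := `|a| `^ (r - 2) * a.

Definition frac_form s r u phi : R :=
  \int[(leb \x leb)%E]_z
    (signed_pow r (u z.1 - u z.2) * (phi z.1 - phi z.2) /
       l2norm (z.1 - z.2) `^ (d%:R + s * r)).

(* Rintegral is 0 on non-integrable functions; here, for bounded Omega, q < p
   and s2 < s1, Hoelder and W0 s1 p Omega `<=` W0 s2 q Omega make the four
   integrands integrable. *)
Definition weak_solution (s1 s2 p q alpha beta : R) Omega u : Prop :=
  W0 s1 p Omega u /\
  forall phi, W0 s1 p Omega phi ->
    frac_form s1 p u phi + frac_form s2 q u phi =
      alpha * (\int[leb]_(x in Omega) (signed_pow p (u x) * phi x)) +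
      beta * (\int[leb]_(x in Omega) (signed_pow q (u x) * phi x)).

End fractional_sobolev.

(* Main.v *)
Require Import Defs.
From HB Require Import structures.
From mathcomp Require Import all_boot all_order all_algebra.
From mathcomp Require Import all_classical all_reals all_analysis.
From mathcomp Require Import measurable_realfun ess_sup_inf ring lra.
Import Order.TTheory GRing.Theory Num.Theory.
Import numFieldNormedType.Exports.
Local Open Scope classical_set_scope.
Local Open Scope ring_scope.

(* Testing the equation with w = (u - k)^+ for k >= 1 bounds [w]_{s1,p}^p by a
   multiple of the integral of u^p over {u > k}; the q-form is nonnegative and
   can be dropped. The Sobolev embedding is replaced by a Faber-Krahn inequality:
   if {w <> 0} fills at most half of a cube of half-side rho, then around each of
   its points the other half of the cube already contributes c rho^(-s1 p) |w|^p
   to the Gagliardo seminorm. Combining the two, with levels K (2 - 2^-j) and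
   radii rho0 2^(-j/s1), the measures of the superlevel sets decay geometrically
   (De Giorgi iteration), so that {u > 2 K} is null. *)

(* Unlike [ge0_le_integral], no measurability is required: in particular an open
   set of 'rV[R]_d need not be shown to be measurable. *)
Lemma ge0_le_integral_nomeas d (T : measurableType d) (R : realType)
  (mu : {measure set T -> \bar R}) (D : set T) (f g : T -> \bar R) :
  (forall x, (0 <= f x)%E) -> (forall x, (f x <= g x)%E) ->
  (\int[mu]_(x in D) f x <= \int[mu]_x g x)%E.
Proof.
move=> f0 fg; rewrite integral_mkcond.
have h0 x : (0 <= (f \_ D) x)%E by apply: erestrict_ge0 => // y _.
rewrite !ge0_integralTE//; last by move=> x; exact: le_trans (fg x).
apply: ereal_sup_le => _ /= [h hf <-]; exists h => // x.
apply: le_trans (hf x) _; rewrite /patch; case: ifP => _ //.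
exact: le_trans (fg x).
Qed.

(** * Euclidean norm and measurability of the Gagliardo kernel *)

Lemma l2norm_ge0 (R : realType) d (x : 'rV[R]_d) : 0 <= l2norm x.
Proof. exact: sqrtr_ge0. Qed.

Lemma l2norm_gt0 (R : realType) d (x : 'rV[R]_d) : x != 0 -> 0 < l2norm x.
Proof.
move=> x0; rewrite sqrtr_gt0 lt_neqAle sumr_ge0 ?andbT => [|i _]; last first.
  exact: sqr_ge0.
apply: contra x0 => /eqP/esym/eqP.
rewrite psumr_eq0 => [/allP h|i _]; last exact: sqr_ge0.
apply/eqP/rowP => i; rewrite mxE; apply/eqP.
by have := h i; rewrite mem_index_enum sqrf_eq0; exact.
Qed.

Lemma l2norm_le (R : realType) d (x : 'rV[R]_d) (rho : R) :
  0 <= rho -> (forall i, `|x ord0 i| <= rho) -> l2norm x <= d%:R * rho.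
Proof.
move=> rho0 h; rewrite -[leRHS]ger0_norm ?mulr_ge0// -sqrtr_sqr ler_sqrt ?sqr_ge0//.
apply: (@le_trans _ _ (\sum_(i < d) rho ^+ 2)).
  by apply: ler_sum => i _; rewrite -[leLHS]real_normK ?num_real// ler_sqr ?nnegrE.
rewrite sumr_const card_ord exprMn -[leLHS]mulr_natl ler_wpM2r ?sqr_ge0//.
by rewrite -natrX ler_nat; case: (d) => // n; rewrite leq_pmulr.
Qed.

Lemma measurable_l2norm_sub (R : realType) d :
  measurable_fun setT (fun z : 'rV[R]_d * 'rV[R]_d => l2norm (z.1 - z.2)).
Proof.
rewrite [X in measurable_fun _ X](_ : _ = fun z : 'rV[R]_d * 'rV[R]_d =>
   (\sum_(i < d) (z.1 ord0 i - z.2 ord0 i) ^+ 2) `^ 2^-1); last first.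
  apply/funext => z; rewrite powR12_sqrt.
    by rewrite /l2norm; under eq_bigr do rewrite !mxE.
  by rewrite sumr_ge0// => i _; rewrite sqr_ge0.
apply: (measurableT_comp (measurable_powR _)).
apply: measurable_sum => i; apply: measurable_funX.
by apply: measurable_funB;
  [apply: (measurableT_comp (measurable_coord_rV i) measurable_fst)
  |apply: (measurableT_comp (measurable_coord_rV i) measurable_snd)].
Qed.

Lemma measurable_div_l2norm (R : realType) d (F : 'rV[R]_d * 'rV[R]_d -> R) e :
  measurable_fun setT F ->
  measurable_fun setT (fun z => F z / l2norm (z.1 - z.2) `^ e).
Proof.
move=> mF; under eq_fun do rewrite -powRN.
apply: measurable_funM => //.
exact: (measurableT_comp (measurable_powR _) (measurable_l2norm_sub _ _)).
Qed.

Lemma measurable_sub12 (R : realType) d (u : 'rV[R]_d -> R) :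
  measurable_fun setT u ->
  measurable_fun setT (fun z : 'rV[R]_d * 'rV[R]_d => u z.1 - u z.2).
Proof.
move=> mu; apply: measurable_funB; apply: (measurableT_comp mu).
  exact: measurable_fst.
exact: measurable_snd.
Qed.

Lemma measurable_normpow d (T : measurableType d) (R : realType) (u : T -> R) r :
  measurable_fun setT u -> measurable_fun setT (fun x => `|u x| `^ r).
Proof.
move=> mu; apply: (measurableT_comp (measurable_powR _)).
exact: measurableT_comp.
Qed.

(** * Cubes and the Faber-Krahn inequality *)

Definition cube {R : realType} {d} (x : 'rV[R]_d) (rho : R) : set 'rV[R]_d :=
  [set y | forall i, `[x ord0 i - rho, x ord0 i + rho]%classic (y ord0 i)].

Lemma measurable_cube (R : realType) d (x : 'rV[R]_d) rho :
  measurable (cube x rho).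
Proof.
rewrite (_ : cube x rho = \bigcap_(j in [set` 'I_d])
   ((fun y : 'rV[R]_d => y ord0 j) @^-1` `[x ord0 j - rho, x ord0 j + rho])); last first.
  by apply/seteqP; split => y /= h j; [move=> _|]; exact: h.
apply: fin_bigcap_measurable => //= j _.
by rewrite -[X in measurable X]setTI; exact: measurable_coord_rV.
Qed.

Lemma lebesgue_rV_cube (R : realType) d (x : 'rV[R]_d) rho : 0 < rho ->
  lebesgue_rV d (cube x rho) = ((2 * rho) ^+ d)%:E.
Proof.
move=> rho0; rewrite (lebesgue_rV_box (A := fun i =>
  [set` `[x ord0 i - rho, x ord0 i + rho]]))//.
rewrite (eq_bigr (fun=> (2 * rho)%:E)); last first.
  move=> i _; rewrite lebesgue_measure_itv/= lte_fin ifT; last by lra.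
  by rewrite -EFinB; congr EFin; ring.
by rewrite prodEFin prodr_const card_ord.
Qed.

(** The [r]-th power of [gagliardo]: without the outer root, integrands can be compared directly. *)
Definition energy {R : realType} {d} (s r : R) (u : 'rV[R]_d -> R) : \bar R :=
  (\int[(lebesgue_rV d \x lebesgue_rV d)%E]_z
     (`|u z.1 - u z.2| `^ r / l2norm (z.1 - z.2) `^ (d%:R + s * r))%:E)%E.

Lemma gagliardo_lty (R : realType) d (s r : R) (u : 'rV[R]_d -> R) : 0 < r ->
  (gagliardo s r u < +oo)%E <-> (energy s r u < +oo)%E.
Proof.
move=> r0; split; last exact: poweR_lty.
by apply: lty_poweRy; rewrite invr_neq0// gt_eqF.
Qed.

(** Half the volume of a cube of half-side [rho], divided by a bound for the kernel's denominator:
    points of the cube are within Euclidean distance [d rho] of its centre. *)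
Definition faber_krahn_const {R : realType} (d : nat) (s r rho : R) : R :=
  ((2 * rho) ^+ d / 2) / (d%:R * rho) `^ (d%:R + s * r).

(** By Tonelli it suffices to bound the integral in [y] from below for each [x] with [v x != 0].
    Where [v y = 0] the numerator is [|v x| ^ r]. *)
Lemma faber_krahn (R : realType) d (s r rho : R) (v : 'rV[R]_d -> R) :
  (0 < d)%N -> 0 < r -> 0 < s -> 0 < rho -> measurable_fun setT v ->
  (lebesgue_rV d [set x | v x != 0%R] <= ((2 * rho) ^+ d / 2)%:E)%E ->
  ((faber_krahn_const d s r rho)%:E * \int[lebesgue_rV d]_x (`|v x| `^ r)%:E
     <= energy s r v)%E.
Proof.
move=> d0 r0 s0 rho0 mv hA.
set A := [set x | _] in hA; set e := d%:R + s * r; set m := (2 * rho) ^+ d.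
have dr0 : 0 < d%:R * rho by rewrite mulr_gt0 ?ltr0n.
have e0 : 0 < e by rewrite addr_gt0 ?ltr0n// mulr_gt0.
have m0 : 0 < m by rewrite exprn_gt0// mulr_gt0.
have c0 : 0 <= faber_krahn_const d s r rho.
  by rewrite divr_ge0 ?powR_ge0// divr_ge0// ltW.
have mA : measurable A.
  rewrite (_ : A = v @^-1` (~` [set 0])); last first.
    by apply/seteqP; split => x /= /eqP.
  by rewrite -[X in measurable X]setTI; apply: mv => //; exact: measurableC.
pose f := fun z : 'rV[R]_d * 'rV[R]_d =>
  (`|v z.1 - v z.2| `^ r / l2norm (z.1 - z.2) `^ e)%:E.
have f0 z : (0 <= f z)%E by rewrite lee_fin divr_ge0 ?powR_ge0.
have mf : measurable_fun setT f.
  apply/measurable_EFinP; apply: measurable_div_l2norm.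
  by apply: measurable_normpow; exact: measurable_sub12.
rewrite /energy fubini_tonelli1//.
rewrite -ge0_integralZl//; last first.
  by apply/measurable_EFinP; exact: measurable_normpow.
apply: ge0_le_integral_nomeas => x.
  by rewrite -EFinM lee_fin mulr_ge0 ?powR_ge0.
have [vx0|vx0] := eqVneq (v x) 0.
  rewrite vx0 normr0 powR0 ?gt_eqF// mule0.
  by apply: integral_ge0 => y _; exact: f0.
(* At least half of the cube, since [A] takes at most [m / 2] of its measure [m]. *)
pose B := cube x rho `\` A.
have mB : measurable B by apply: measurableD => //; exact: measurable_cube.
have hB : ((m / 2)%:E <= lebesgue_rV d B)%E.
  have : (m%:E <= lebesgue_rV d B + (m / 2)%:E)%E.
    rewrite -(lebesgue_rV_cube R d x rho)//.
    rewrite (measureDI _ (measurable_cube R d x rho) mA) leeD2l//.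
    apply: (le_trans _ hA); apply: le_measure; rewrite ?inE//.
      exact: measurableI (measurable_cube _ _ _ _) mA.
  rewrite -leeBlDr// -EFinB (_ : m - m / 2 = m / 2)//.
  by field.
pose b := `|v x| `^ r / (d%:R * rho) `^ e.
have b0 : 0 <= b by rewrite divr_ge0 ?powR_ge0.
apply: (@le_trans _ _ (\int[lebesgue_rV d]_y (b%:E * (\1_B y)%:E)%E)%E).
  rewrite ge0_integralZl//; last first.
    by apply/measurable_EFinP; exact: measurable_indic.
  rewrite integral_indic// setIT.
  rewrite (_ : (_ * _)%E = (b%:E * (m / 2)%:E)%E).
    by apply: lee_wpmul2l => //; rewrite lee_fin.
  rewrite -!EFinM; congr EFin; rewrite /b /faber_krahn_const -/e -/m; ring.
apply: ge0_le_integral_nomeas => y.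
  by rewrite -EFinM lee_fin mulr_ge0// indicE.
rewrite indicE; case: (boolP (y \in B)) => [|_]; last first.
  by rewrite mule0; exact: f0.
rewrite inE => -[Qy Ay]; rewrite mule1 /f lee_fin /b /=.
have vy : v y = 0 by apply/eqP; apply: contra_notT Ay.
rewrite vy subr0 ler_wpM2l ?powR_ge0//.
(* Off the diagonal the denominator is positive, so inversion reverses the inequality; at [x = y] it
   would be 0, with inverse 0. *)
have xy : x - y != 0.
  by rewrite subr_eq0; apply: contra_neq vx0 => ->.
rewrite lef_pV2 ?posrE ?powR_gt0 ?l2norm_gt0//.
rewrite ge0_ler_powR ?nnegrE ?l2norm_ge0 ?(ltW e0) ?(ltW dr0)//.
apply: l2norm_le => [|i]; first exact: ltW.
have := Qy i; rewrite /= in_itv/= !mxE => /andP[h1 h2].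
by rewrite ler_norml; apply/andP; split; lra.
Qed.

(** * Truncations and pointwise inequalities *)

(** The signs of [t] and [tau] agree, so the product is [|tau| |t| ^ (r - 1)]; using [|tau| <= |t|]
    in one factor or the other gives the two bounds. *)
Lemma signed_pow_mul_bounds (R : realType) (r t tau : R) :
  1 < r -> 0 <= t * tau -> `|tau| <= `|t| ->
  `|tau| `^ r <= signed_pow r t * tau <= `|t| `^ r.
Proof.
move=> r1 h0 h1.
have r10 : 0 < r - 1 by rewrite subr_gt0.
have r0 : 0 < r by exact: (lt_trans ltr01 r1).
have -> : signed_pow r t * tau = `|tau| * `|t| `^ (r - 1).
  rewrite /signed_pow -mulrA -(ger0_norm h0) normrM.
  rewrite (_ : r - 2 = r - 1 - 1); last by ring.
  (* [|t| |t| ^ (r - 2) = |t| ^ (r - 1)] holds at [t = 0] too, because [r - 1 > 0]. *)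
  by rewrite -(mulr_powRB1 (normr_ge0 t) r10); ring.
rewrite -(mulr_powRB1 (normr_ge0 tau) r0) -(mulr_powRB1 (normr_ge0 t) r0).
rewrite ler_wpM2r ?powR_ge0// andbT ler_wpM2l//.
by rewrite ge0_ler_powR ?nnegrE// ltW.
Qed.

Definition trunc {R : realType} {T} (u : T -> R) (k : R) : T -> R :=
  fun x => Num.max (u x - k) 0.

Section trunc.
Context {R : realType} {T : Type}.
Implicit Types (u : T -> R) (k : R).

Lemma trunc_ge0 u k x : 0 <= trunc u k x.
Proof. by rewrite le_max lexx orbT. Qed.

Lemma trunc_eq0 u k x : u x <= k -> trunc u k x = 0.
Proof. by move=> h; apply/max_idPr; rewrite subr_le0. Qed.

Lemma trunc_neq0 u k : [set x | trunc u k x != 0] = [set x | k < u x].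
Proof.
apply/seteqP; split => x /=.
  by apply: contra_neqT; rewrite -leNgt; exact: trunc_eq0.
by move=> h; rewrite gt_eqF// lt_max subr_gt0 h.
Qed.

(** Together with [trunc_sub_lipschitz], this verifies the hypotheses of [signed_pow_mul_bounds] for
    the differences in the forms. *)
Lemma trunc_sub_monotone u k x y :
  0 <= (u x - u y) * (trunc u k x - trunc u k y).
Proof.
rewrite /trunc; have [h|h] := leP (u x) (u y).
  rewrite mulr_le0 ?subr_le0//.
  by rewrite /Num.max; case: ifP => ?; case: ifP => ?; lra.
rewrite mulr_ge0 ?subr_ge0 ?(ltW h)//.
by rewrite /Num.max; case: ifP => ?; case: ifP => ?; lra.
Qed.

Lemma trunc_sub_lipschitz u k x y :
  `|trunc u k x - trunc u k y| <= `|u x - u y|.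
Proof.
rewrite /trunc /Num.max.
by case: ifP => ?; case: ifP => ?; case: ler0P => ?; case: ler0P => ?; lra.
Qed.

(** With [trunc_norm_le], the same hypotheses for [t = u x], as needed on the right-hand side of the
    equation. *)
Lemma trunc_mul_ge0 u k x : 0 <= k -> 0 <= u x * trunc u k x.
Proof.
move=> k0; have [h|h] := leP (u x) k; first by rewrite trunc_eq0// mulr0.
by rewrite mulr_ge0 ?trunc_ge0// ltW// (le_lt_trans k0).
Qed.

Lemma trunc_norm_le u k x : 0 <= k -> `|trunc u k x| <= `|u x|.
Proof.
move=> k0; have [h|h] := leP (u x) k; first by rewrite trunc_eq0// normr0.
rewrite !ger0_norm ?trunc_ge0//; last by rewrite ltW// (le_lt_trans k0).
by rewrite /trunc /Num.max; case: ifP => ?; lra.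
Qed.

End trunc.

Lemma measurable_trunc d (T : measurableType d) (R : realType) (u : T -> R) k :
  measurable_fun setT u -> measurable_fun setT (trunc u k).
Proof. by move=> mu; apply: measurable_maxr => //; exact: measurable_funB. Qed.

Lemma measurable_superlevel d (T : measurableType d) (R : realType) (u : T -> R) k :
  measurable_fun setT u -> measurable [set x | k < u x].
Proof.
move=> mu; rewrite (_ : mkset _ = u @^-1` [set` `]k, +oo[]); last first.
  by apply/seteqP; split => x /=; rewrite in_itv/= andbT.
by rewrite -[X in measurable X]setTI; exact: mu.
Qed.

(** * Truncations as test functions *)

Lemma LfunP_lty d (T : measurableType d) (R : realType)
    (mu : {measure set T -> \bar R}) (r : R) (u : T -> R) : 0 < r ->
  u \in Lfun mu r%:E <->
  measurable_fun setT u /\ (\int[mu]_x (`|u x| `^ r)%:E < +oo)%E.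
Proof.
move=> r0; have r0' := gt_eqF r0.
have E : ('N[mu]_r%:E[EFin \o u] `^ r = \int[mu]_x (`|u x| `^ r)%:E)%E.
  by rewrite poweR_Lnorm ?r0'.
split.
  case/andP; rewrite !inE /= => mu' /(poweR_lty r); rewrite E => h.
  by split => //.
case=> mu'; rewrite -E => /lty_poweRy h.
by apply/andP; rewrite !inE /=; split => //; apply: h; rewrite r0'.
Qed.

(** Makes the truncation admissible: for [k >= 0], [max (t - k) 0] is 1-Lipschitz and fixes 0, so
    neither integral increases and zeros of [u] are kept. *)
Lemma trunc_W0 (R : realType) d (s r k : R) (Omega : set 'rV[R]_d) u :
  1 < r -> 0 <= k -> W0 s r Omega u -> W0 s r Omega (trunc u k).
Proof.
move=> r1; have r0 : 0 < r by exact: (lt_trans ltr01 r1).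
move=> k0 [/(LfunP_lty _ _ _ _ _ _ r0)[mu ui] uE u0].
split.
- apply/LfunP_lty => //; split; first exact: measurable_trunc.
  apply: le_lt_trans ui; apply: ge0_le_integral_nomeas => x.
    by rewrite lee_fin powR_ge0.
  by rewrite lee_fin ge0_ler_powR ?nnegrE ?trunc_norm_le// ltW.
- apply/gagliardo_lty => //; move/(gagliardo_lty _ _ _ _ _ r0) : uE.
  apply: le_lt_trans; apply: ge0_le_integral_nomeas => z.
    by rewrite lee_fin divr_ge0 ?powR_ge0.
  rewrite lee_fin ler_wpM2r ?invr_ge0 ?powR_ge0//.
  by rewrite ge0_ler_powR ?nnegrE ?trunc_sub_lipschitz// ltW.
- by apply: filterS u0 => x /[apply] ux; rewrite trunc_eq0 ?ux.
Qed.

(** * The energy estimate *)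

Lemma Rintegral_le d (T : measurableType d) (R : realType)
  (mu : {measure set T -> \bar R}) (D : set T) (f g : T -> R) (M : R) :
  (forall x, 0 <= f x) -> (forall x, f x <= g x) ->
  (\int[mu]_x (g x)%:E <= M%:E)%E -> \int[mu]_(x in D) f x <= M.
Proof.
move=> f0 fg gM.
have h : (\int[mu]_(x in D) (f x)%:E <= M%:E)%E.
  apply: le_trans gM; apply: ge0_le_integral_nomeas => x.
    by rewrite lee_fin.
  by rewrite lee_fin.
have h0 : (0 <= \int[mu]_(x in D) (f x)%:E)%E.
  by apply: integral_ge0 => x _; rewrite lee_fin.
rewrite -lee_fin /Rintegral fineK// ge0_fin_numE//.
by rewrite (le_lt_trans h)// ltry.
Qed.

(** The lower bound of [signed_pow_mul_bounds] gives the inequality. The upper bound gives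
    finiteness, without which [fine] would turn the form into 0. *)
Lemma energy_le_frac_form (R : realType) d (s p k : R) (u : 'rV[R]_d -> R) :
  1 < p -> (energy s p u < +oo)%E ->
  (energy s p (trunc u k) <= (frac_form s p u (trunc u k))%:E)%E.
Proof.
move=> p1 uE.
have b (z : 'rV[R]_d * 'rV[R]_d) := signed_pow_mul_bounds R p _ _ p1
  (trunc_sub_monotone u k z.1 z.2) (trunc_sub_lipschitz u k z.1 z.2).
have ge0_kernel (z : 'rV[R]_d * 'rV[R]_d) :
  0 <= (l2norm (z.1 - z.2) `^ (d%:R + s * p))^-1 by rewrite invr_ge0 powR_ge0.
rewrite /frac_form /Rintegral fineK; last first.
  rewrite ge0_fin_numE; last first.
    apply: integral_ge0 => z _; rewrite lee_fin mulr_ge0//.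
    by apply: le_trans (proj1 (andP (b z))); exact: powR_ge0.
  apply: le_lt_trans uE; apply: ge0_le_integral_nomeas => z.
    rewrite lee_fin mulr_ge0//.
    by apply: le_trans (proj1 (andP (b z))); exact: powR_ge0.
  by rewrite lee_fin ler_wpM2r//; case/andP: (b z).
apply: ge0_le_integral_nomeas => z.
  by rewrite lee_fin mulr_ge0 ?powR_ge0.
by rewrite lee_fin ler_wpM2r//; case/andP: (b z).
Qed.

(** Serves to drop the [q]-form; the integrand is nonnegative pointwise. *)
Lemma frac_form_trunc_ge0 (R : realType) d (s p k : R) (u : 'rV[R]_d -> R) :
  1 < p -> 0 <= frac_form s p u (trunc u k).
Proof.
move=> p1; apply: Rintegral_ge0 => z _.
rewrite divr_ge0 ?powR_ge0//.
have /andP[h _] := signed_pow_mul_bounds R p _ _ p1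
  (trunc_sub_monotone u k z.1 z.2) (trunc_sub_lipschitz u k z.1 z.2).
by apply: le_trans h; exact: powR_ge0.
Qed.

(** Where the truncation is nonzero, [u x > k >= 1], so the power [r] is dominated by the power [p].
    This covers both [r = p] and [r = q]. *)
Lemma signed_pow_trunc_bounds (R : realType) T (p r k : R) (u : T -> R) x :
  1 < r -> r <= p -> 1 <= k ->
  0 <= signed_pow r (u x) * trunc u k x <= `|u x| `^ p * \1_[set y | k < u y] x.
Proof.
move=> r1 rp k1; have k0 : 0 <= k by exact: (le_trans ler01 k1).
rewrite indicE; have [h|h] := leP (u x) k.
  rewrite trunc_eq0// mulr0 lexx memNset ?mulr0 ?lexx//= .
  by apply/negP; rewrite -leNgt.
rewrite mem_set// mulr1.
have /andP[h1 h2] := signed_pow_mul_bounds R r _ _ r1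
  (trunc_mul_ge0 u k x k0) (trunc_norm_le u k x k0).
rewrite (le_trans _ h1) ?powR_ge0//= (le_trans h2)// ler_powR//.
by rewrite ger0_norm; lra.
Qed.

(** A Caccioppoli-type estimate: both terms on the right are controlled by the same integral, and
    absolute values allow coefficients of either sign. *)
Lemma energy_trunc_le (R : realType) d (s1 s2 p q alpha beta k : R)
    (Omega : set 'rV[R]_d) (u : 'rV[R]_d -> R) :
  1 < q -> q < p -> 1 <= k ->
  weak_solution s1 s2 p q alpha beta Omega u ->
  (energy s1 p (trunc u k) <= (`|alpha| + `|beta|)%:E *
    \int[lebesgue_rV d]_x (`|u x| `^ p * \1_[set y | k < u y] x)%:E)%E.
Proof.
move=> q1 qp k1 [uW hu]; have p1 : 1 < p by exact: (lt_trans q1 qp).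
have k0 : 0 <= k by exact: (le_trans ler01 k1).
have /hu {hu} := trunc_W0 _ _ _ _ _ _ _ p1 k0 uW.
have p0 : 0 < p by exact: (lt_trans ltr01 p1).
have [/(LfunP_lty _ _ _ _ _ _ p0)[mu ui] /(gagliardo_lty _ _ _ _ _ p0) uE _] := uW.
set J := (\int[_]_x _)%E.
have J0 : (0 <= J)%E.
  by apply: integral_ge0 => x _; rewrite lee_fin mulr_ge0 ?powR_ge0 ?indicE.
have JE : J \is a fin_num.
  rewrite ge0_fin_numE//; apply: le_lt_trans ui.
  apply: ge0_le_integral_nomeas => x.
    by rewrite lee_fin mulr_ge0 ?powR_ge0 ?indicE.
  by rewrite lee_fin ler_piMr ?powR_ge0// indicE lern1 leq_b1.
set a := (\int[_]_(x in _) _); set b := (\int[_]_(x in _) _) => hform.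
have term_bound r : 1 < r -> r <= p ->
    0 <= \int[lebesgue_rV d]_(x in Omega) (signed_pow r (u x) * trunc u k x)
      <= fine J.
  move=> r1 rp.
  have h x := andP (signed_pow_trunc_bounds R _ p r k u x r1 rp k1).
  apply/andP; split; first by apply: Rintegral_ge0 => x _; case: (h x).
  apply: (Rintegral_le _ _ _ _ _ _ (fun x => `|u x| `^ p * \1_[set y | k < u y] x)).
  - by move=> x; case: (h x).
  - by move=> x; case: (h x).
  - by rewrite fineK.
have /andP[a0 aJ] : 0 <= a <= fine J by exact: term_bound.
have /andP[b0 bJ] : 0 <= b <= fine J by apply: term_bound => //; exact: ltW.
apply: le_trans (energy_le_frac_form _ _ _ _ k _ p1 uE) _.
rewrite -(fineK JE) -EFinM lee_fin.
have q0 := frac_form_trunc_ge0 R d s2 q k u q1.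
(* The nonnegative [q]-form is dropped here. *)
apply: (@le_trans _ _ (alpha * a + beta * b)); first by rewrite -hform lerDl.
rewrite mulrDl lerD//.
  by rewrite (le_trans (ler_norm _))// normrM (ger0_norm a0) ler_wpM2l.
by rewrite (le_trans (ler_norm _))// normrM (ger0_norm b0) ler_wpM2l.
Qed.

(** Volume scales as [rho ^ d], the denominator as [rho ^ (d + s r)]. For [s r > 0] the constant
    blows up as [rho] shrinks, so small cubes can absorb the right-hand side. *)
Lemma faber_krahn_constE (R : realType) (d : nat) (s r rho : R) :
  (0 < d)%N -> 0 < rho ->
  faber_krahn_const d s r rho = faber_krahn_const d s r 1 / rho `^ (s * r).
Proof.
move=> d0 rho0; rewrite /faber_krahn_const !mulr1 powRM ?(ltW rho0)//.
rewrite [rho `^ (_ + _)]powRD; last by rewrite (gt_eqF rho0) implybT.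
rewrite powR_mulrn ?ltW// exprMn.
have h1 : rho ^+ d != 0 by rewrite expf_neq0// gt_eqF.
have h2 : rho `^ (s * r) != 0 by rewrite gt_eqF// powR_gt0.
have h3 : (d%:R : R) `^ (d%:R + s * r) != 0 by rewrite gt_eqF// powR_gt0// ltr0n.
by field; rewrite h1 h2 h3.
Qed.

Lemma faber_krahn_const_gt0 (R : realType) (d : nat) (s r rho : R) :
  (0 < d)%N -> 0 < rho -> 0 < faber_krahn_const d s r rho.
Proof.
move=> d0 rho0; apply: divr_gt0.
  by rewrite divr_gt0// exprn_gt0// mulr_gt0.
by rewrite powR_gt0// mulr_gt0 ?ltr0n.
Qed.

(** * Measures of superlevel sets and one step of the iteration *)

Section truncated_integrals.
Context d (T : measurableType d) (R : realType)
  (mu : {measure set T -> \bar R}) (u : T -> R) (p : R).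
Hypothesis mu_u : measurable_fun setT u.
Hypothesis p0 : 0 < p.

(** Chebyshev: [trunc u k > delta] wherever [u > k + delta]. *)
Lemma measure_superlevel_le (k delta : R) : 0 <= delta ->
  ((delta `^ p)%:E * mu [set x | (k + delta < u x)%R]
    <= \int[mu]_x (`|trunc u k x| `^ p)%:E)%E.
Proof.
move=> delta0; have mA := measurable_superlevel _ _ _ _ (k + delta) mu_u.
rewrite -[X in mu X]setIT -integral_indic// -ge0_integralZl//; last 2 first.
- by apply/measurable_EFinP; exact: measurable_indic.
- by rewrite lee_fin powR_ge0.
apply: ge0_le_integral_nomeas => x.
  by rewrite -EFinM lee_fin mulr_ge0 ?powR_ge0 ?indicE.
rewrite -EFinM lee_fin indicE.
case: (boolP (x \in _)) => [|_]; last by rewrite mulr0 powR_ge0.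
rewrite inE mulr1 /= => h.
rewrite ge0_ler_powR ?nnegrE//; first exact: ltW.
rewrite ger0_norm ?trunc_ge0// /trunc le_max.
by apply/orP; left; lra.
Qed.

Hypothesis u_int : (\int[mu]_x (`|u x| `^ p)%:E < +oo)%E.

Lemma integral_trunc_lty k : 0 <= k ->
  (\int[mu]_x (`|trunc u k x| `^ p)%:E < +oo)%E.
Proof.
move=> k0; apply: le_lt_trans u_int; apply: ge0_le_integral_nomeas => x.
  by rewrite lee_fin powR_ge0.
by rewrite lee_fin ge0_ler_powR ?nnegrE ?trunc_norm_le// ltW.
Qed.

Lemma measure_superlevel_lty k : 0 < k -> (mu [set x | (k < u x)%R] < +oo)%E.
Proof.
(* Chebyshev at truncation level 0 with [delta = k]. *)
move=> k0; have := measure_superlevel_le 0 k (ltW k0); rewrite add0r => h.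
have kp : 0 < k `^ p by exact: powR_gt0.
have := le_lt_trans h (integral_trunc_lty 0 (lexx 0)).
by rewrite -lte_pdivlMl// gt0_muley// lte_fin invr_gt0.
Qed.

Lemma measure_superlevel_small (eta : R) : 1 <= p -> 0 < eta ->
  exists2 K, 1 <= K & fine (mu [set x | (K < u x)%R]) <= eta.
Proof.
move=> p1 eta0; have := integral_trunc_lty 0 (lexx 0).
set J := (\int[_]_x _)%E => Joo.
have J0 : (0 <= J)%E by apply: integral_ge0 => x _; rewrite lee_fin powR_ge0.
(* With [m] the measure at level [K], [K m <= K ^ p m <= J <= K eta]: the first inequality uses
   [K >= 1] and [p >= 1], the last [K >= J / eta]. *)
pose K := Num.max 1 (fine J / eta).
have K1 : 1 <= K by rewrite le_max lexx.
have K0 : 0 < K by exact: lt_le_trans K1.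
exists K => //; have := measure_superlevel_le 0 K (ltW K0).
rewrite -/J add0r => h.
have mE : mu [set x | K < u x] \is a fin_num.
  by rewrite ge0_fin_numE// measure_superlevel_lty.
move: h; rewrite -(fineK mE) -EFinM -(@fineK _ J) ?ge0_fin_numE// lee_fin /=.
set m := fine (mu _) => h.
have m0 : 0 <= m by exact: fine_ge0.
have KJ : fine J <= K * eta by rewrite -ler_pdivrMr// le_max lexx orbT.
rewrite -(ler_pM2l K0) (le_trans _ KJ)// (le_trans _ h)//.
by rewrite ler_wpM2r// le1r_powR.
Qed.

(** On [{u > k}], [u] is the truncation plus [k], hence at most twice the larger of the two; the
    power of a maximum is at most the sum of the powers. *)
Lemma integral_superlevel_le k : 0 < k ->
  (\int[mu]_x (`|u x| `^ p * \1_[set y | (k < u y)%R] x)%:E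
    <= (2 `^ p)%:E * (\int[mu]_x (`|trunc u k x| `^ p)%:E
         + (k `^ p)%:E * mu [set x | (k < u x)%R]))%E.
Proof.
move=> k0; have mA := measurable_superlevel _ _ _ _ k mu_u.
have mI : measurable_fun setT (fun x => (\1_[set y | (k < u y)%R] x : R)%:E).
  by apply/measurable_EFinP; exact: measurable_indic.
have mt : measurable_fun setT (fun x => (`|trunc u k x| `^ p)%:E).
  by apply/measurable_EFinP/measurable_normpow; exact: measurable_trunc.
rewrite -[X in mu X]setIT -integral_indic// -ge0_integralZl//; last first.
  by rewrite lee_fin powR_ge0.
rewrite -ge0_integralD//; last 2 first.
- by move=> x _; rewrite -EFinM lee_fin mulr_ge0 ?powR_ge0.
- exact: measurable_funeM.
rewrite -ge0_integralZl//; last 2 first.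
- by apply: emeasurable_funD => //; exact: measurable_funeM.
- by move=> x _; rewrite -EFinM lee_fin addr_ge0 ?mulr_ge0 ?powR_ge0.
apply: ge0_le_integral_nomeas => x.
  by rewrite lee_fin mulr_ge0 ?powR_ge0 ?indicE.
rewrite -EFinM lee_fin indicE.
case: (boolP (x \in _)) => [|_]; last first.
  by rewrite !mulr0 addr0 mulr_ge0 ?powR_ge0.
rewrite inE !mulr1 /= => h.
set w := `|trunc u k x|.
have w0 : 0 <= w by exact: normr_ge0.
have mx0 : 0 <= Num.max w k by rewrite le_max w0.
have huw : `|u x| <= 2 * Num.max w k.
  have -> : w = u x - k.
    by rewrite /w ger0_norm ?trunc_ge0//; apply/max_idPl; lra.
  by rewrite ger0_norm /Num.max; [case: ifP => ?; lra|lra].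
apply: (@le_trans _ _ ((2 * Num.max w k) `^ p)).
  by rewrite ge0_ler_powR ?nnegrE ?(ltW p0)// mulr_ge0.
rewrite powRM ?le_max ?w0// ler_wpM2l ?powR_ge0//.
by have [_|_] := leP w k; rewrite ?lerDl ?lerDr powR_ge0.
Qed.

(** The integral hypothesis is Faber-Krahn followed by the energy estimate. With [X] the integral of
    the truncation and [D = C 2 ^ p], it yields [c X <= D X + D k ^ p m]; as [2 D <= c], the finite
    term [D X] is absorbed, and Chebyshev bounds [c X / 2] from below. *)
Lemma superlevel_decay (c C k delta : R) : 0 <= C -> 0 < k -> 0 <= delta ->
  2 * (C * 2 `^ p) <= c ->
  (c%:E * \int[mu]_x (`|trunc u k x| `^ p)%:E <=
   C%:E * \int[mu]_x (`|u x| `^ p * \1_[set y | (k < u y)%R] x)%:E)%E ->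
  c / 2 * delta `^ p * fine (mu [set x | k + delta < u x]) <=
  C * 2 `^ p * k `^ p * fine (mu [set x | k < u x]).
Proof.
move=> C0 k0 delta0 hc hE.
have kd0 : 0 < k + delta by rewrite ltr_wpDr.
have := integral_trunc_lty k (ltW k0).
have hX : (0 <= \int[mu]_x (`|trunc u k x| `^ p)%:E)%E.
  by apply: integral_ge0 => x _; rewrite lee_fin powR_ge0.
rewrite -ge0_fin_numE// => /fineK XE.
have /fineK mE : mu [set x | k < u x] \is a fin_num.
  by rewrite ge0_fin_numE// measure_superlevel_lty.
have /fineK m'E : mu [set x | k + delta < u x] \is a fin_num.
  by rewrite ge0_fin_numE// measure_superlevel_lty.
have h1 := measure_superlevel_le k delta delta0.
have h2 := le_trans hE (lee_wpmul2l _ (integral_superlevel_le k k0)).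
move: h1 {h2}(h2 C0); move: hX.
rewrite -XE -mE -m'E -!EFinM !lee_fin.
set X := fine _; set m := fine (mu [set x | k < u x]).
set m' := fine (mu [set x | k + delta < u x]) => X0 h1 h2.
have h3 : c * X <= (C * 2 `^ p) * X + C * 2 `^ p * k `^ p * m.
  by apply: le_trans h2 _; rewrite le_eqVlt; apply/orP; left; apply/eqP; ring.
have D0 : 0 <= C * 2 `^ p by rewrite mulr_ge0 ?powR_ge0.
have hc2 : C * 2 `^ p <= c / 2 by rewrite ler_pdivlMr// mulrC.
apply: (@le_trans _ _ (c / 2 * X)).
  by rewrite -mulrA ler_wpM2l// (le_trans D0).
have h4 : (C * 2 `^ p) * X <= c / 2 * X by rewrite ler_wpM2r.
rewrite (_ : c / 2 * X = c * X - c / 2 * X); last by field.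
by rewrite lerBlDr (le_trans h3)// addrC lerD2l.
Qed.

End truncated_integrals.

(** * De Giorgi iteration *)

(* The radii [rho0 * th ^+ j] are chosen so that the factor [2 ^ (p j)] lost in
   [k / delta] is compensated by [rho `^ (s * p)]; [th ^+ d] is the ratio at which
   the admissible measure [(2 * rho) ^+ d / 2] shrinks. *)
Lemma geometric_decay (R : realType) (d : nat) (s p kappa D : R) (M : R -> R) :
  (0 < d)%N -> 0 < s -> 0 < p -> 0 < kappa -> 0 <= D ->
  (forall k, 0 <= M k) ->
  (forall eta, 0 < eta -> exists2 K, 1 <= K & M K <= eta) ->
  (forall k rho delta, 1 <= k -> 0 < rho -> 0 < delta ->
    M k <= (2 * rho) ^+ d / 2 -> 2 * D <= kappa / rho `^ (s * p) ->
    kappa / rho `^ (s * p) / 2 * delta `^ p * M (k + delta)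
      <= D * k `^ p * M k) ->
  exists K theta, [/\ 1 <= K, 0 < theta, theta < 1 &
    forall j, M (K * (2 - 2^-1 ^+ j)) <= theta ^+ j * M K].
Proof.
move=> d0 s0 p0 kappa0 D0 M0 Msmall step.
pose P : R := 2 `^ p.
have P1 : 1 <= P by rewrite -(powRr0 (2 : R)) ler_powR ?ltW//; lra.
have P0 : 0 < P by exact: lt_le_trans P1.
(* Solves [th ^ (s p) = 1 / P], the factor by which [delta ^ p] shrinks at each step. *)
pose th : R := 2 `^ (- s^-1).
have th0 : 0 < th by exact: powR_gt0.
have th1 : th < 1.
  rewrite /th powRN invf_lt1 ?powR_gt0//.
  rewrite [ltLHS](_ : 1 = 1 `^ s^-1); last by rewrite powR1.
  by rewrite gt0_ltr_powR ?invr_gt0 ?nnegrE// ltr1n.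
have thT : th `^ (s * p) = P^-1.
  rewrite /th -powRrM -powRN; congr powR.
  by field; rewrite gt_eqF.
have thX j : (th ^+ j) `^ (s * p) = P^-1 ^+ j.
  rewrite -(powR_mulrn _ (ltW th0)) powRAC thT powR_mulrn//.
  by rewrite invr_ge0 ltW.
have thd0 : 0 < th ^+ d by rewrite exprn_gt0.
have thd1 : th ^+ d < 1 by rewrite exprn_ilt1 ?ltW//; case: (d) d0.
(* The future value of [rho0 ^ (s p)], small enough for [hA], which closes the induction; [D + 1]
   keeps the divisor positive when [D = 0]. *)
pose A := th ^+ d * kappa / (2 * (D + 1) * P ^+ 2).
have D10 : 0 < 2 * (D + 1) * P ^+ 2 by rewrite !mulr_gt0 ?exprn_gt0//; lra.
have A0 : 0 < A by apply: divr_gt0 => //; exact: mulr_gt0.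
have hA : 2 * D * A * P ^+ 2 <= th ^+ d * kappa.
  have -> : th ^+ d * kappa = A * (2 * (D + 1) * P ^+ 2).
    by rewrite /A divfK// gt_eqF.
  rewrite -subr_ge0 (_ : _ - _ = 2 * A * P ^+ 2); last by ring.
  by apply: mulr_ge0; [exact: mulr_ge0 (ltW A0)|exact: exprn_ge0 (ltW P0)].
clearbody A.
pose rho0 := A `^ (s * p)^-1.
have rho00 : 0 < rho0 by exact: powR_gt0.
have sp0 : 0 < s * p by rewrite mulr_gt0.
have rho0T : rho0 `^ (s * p) = A.
  by rewrite /rho0 -powRrM mulVf ?gt_eqF// powRr1// ltW.
have rhoT j : (rho0 * th ^+ j) `^ (s * p) = A * P^-1 ^+ j.
  by rewrite powRM ?ltW// ?exprn_gt0// rho0T thX.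
have eta0 : 0 < (2 * rho0) ^+ d / 2 by rewrite divr_gt0 ?exprn_gt0 ?mulr_gt0.
have [K K1 MK] := Msmall _ eta0.
have K0 : 0 < K by exact: lt_le_trans K1.
exists K, (th ^+ d); split => //.
elim=> [|j IH]; first by rewrite !expr0 mul1r (_ : 2 - 1 = 1) ?mulr1//; ring.
(* From level [K (2 - h)], the increment [delta = K h / 2] leads to the next level. *)
set h : R := 2^-1 ^+ j in IH *.
have h0 : 0 < h by rewrite exprn_gt0// invr_gt0.
have h1 : h <= 1 by rewrite exprn_ile1 ?invr_ge0//; lra.
rewrite (_ : K * (2 - 2^-1 ^+ j.+1) = K * (2 - h) + K * (h / 2)); last first.
  by rewrite exprSr -/h; field.
have Pj : 0 < P^-1 ^+ j by rewrite exprn_gt0// invr_gt0.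
have Pj1 : P^-1 ^+ j <= 1 by rewrite exprn_ile1 ?invr_ge0 ?(ltW P0)// invf_le1.
have k1 : 1 <= K * (2 - h).
  by rewrite (le_trans K1)// ler_peMr ?(ltW K0)//; lra.
have rj0 : 0 < rho0 * th ^+ j by rewrite mulr_gt0// exprn_gt0.
have dj0 : 0 < K * (h / 2) by rewrite mulr_gt0// divr_gt0.
have c0 : 0 < A * P^-1 ^+ j by rewrite mulr_gt0.
have hc : 2 * D <= kappa / (rho0 * th ^+ j) `^ (s * p).
  rewrite rhoT ler_pdivlMr//.
  apply: (@le_trans _ _ (2 * D * A * P ^+ 2)).
    rewrite mulrA ler_wpM2l ?mulr_ge0 ?(ltW A0)//.
    by rewrite (le_trans Pj1)// exprn_ege1.
  by rewrite (le_trans hA)// ler_piMl ?ltW.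
(* The decay of [M] by [th ^ d] per step matches the shrinking volume of the cubes, so the half-cube
   condition persists. *)
have MK' : M (K * (2 - h)) <= (2 * (rho0 * th ^+ j)) ^+ d / 2.
  apply: (le_trans IH).
  rewrite mulrA exprMn exprAC -mulrA [leRHS]mulrCA.
  by rewrite ler_wpM2l// !exprn_ge0// ltW.
have := step _ _ _ k1 rj0 dj0 MK' hc.
rewrite rhoT.
have -> : (K * (h / 2)) `^ p = K `^ p * (P^-1 ^+ j / P).
  rewrite powRM ?(ltW K0)//; last by rewrite divr_ge0// ltW.
  congr (_ * _).
  have -> : h / 2 = 2 `^ (- j.+1%:R) by rewrite powR_invn// -exprVn exprSr.
  rewrite -powRrM mulNr [j.+1%:R * p]mulrC -mulNr powRrM powRN -/P.
  by rewrite powR_mulrn ?invr_ge0 ?(ltW P0)// exprSr.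
set m := M (K * (2 - h)); set m' := M (_ + _) => hstep.
have m0 : 0 <= m by exact: M0.
have kp : (K * (2 - h)) `^ p <= P * K `^ p.
  rewrite -powRM ?(ltW K0)// ge0_ler_powR ?nnegrE ?(ltW p0) ?mulr_ge0 ?(ltW K0)//.
    by lra.
  by rewrite [leRHS]mulrC ler_wpM2l ?(ltW K0)//; lra.
have Kp : 0 < K `^ p by exact: powR_gt0.
have m'0 : 0 <= m' by exact: M0.
(* In [hstep] the factors [P ^ j] from the radius and [P ^ -j] from [delta ^ p] cancel; the
   remaining constant is at most [th ^ d kappa] by [hA]. *)
have : kappa * m' <= 2 * D * A * P ^+ 2 * m.
  have e1 : kappa / (A * P^-1 ^+ j) / 2 * (K `^ p * (P^-1 ^+ j / P)) * m' =
     (K `^ p / (2 * A * P)) * (kappa * m').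
    by field; rewrite !gt_eqF// exprn_gt0.
  have e2 : D * (P * K `^ p) * m =
     (K `^ p / (2 * A * P)) * (2 * D * A * P ^+ 2 * m).
    by field; rewrite !gt_eqF.
  rewrite -(@ler_pM2l _ (K `^ p / (2 * A * P))); last first.
    by rewrite divr_gt0// !mulr_gt0//.
  rewrite -e1 -e2 (le_trans hstep)// ler_wpM2r// ler_wpM2l//.
move=> hm.
have : kappa * m' <= kappa * (th ^+ d * m).
  by rewrite (le_trans hm)// mulrA [kappa * _]mulrC ler_wpM2r.
rewrite ler_pM2l// => /le_trans; apply.
by rewrite exprS -mulrA ler_wpM2l// ltW.
Qed.

(** * Boundedness of the solution *)

Lemma ae_bounded_Lfun_oo d (T : measurableType d) (R : realType)
    (mu : {measure set T -> \bar R}) (M : R) (u : T -> R) :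
  measurable_fun setT u -> {ae mu, forall x, `|u x| <= M} -> u \in Lfun mu +oo%E.
Proof.
move=> mu_u uM; apply/andP; rewrite !inE /=; split => //.
rewrite /finite_norm unlock /Lnorm; case: ifP => _; last exact: ltry.
apply: (@le_lt_trans _ _ M%:E); last exact: ltry.
by apply/ess_supP; apply: filterS uM => x; rewrite /= lee_fin.
Qed.

Lemma superlevel_null (R : realType) d (s1 s2 p q alpha beta : R)
    (Omega : set 'rV[R]_d) (u : 'rV[R]_d -> R) :
  (0 < d)%N -> 0 < s1 -> 1 < q -> q < p ->
  weak_solution s1 s2 p q alpha beta Omega u ->
  exists M, lebesgue_rV d [set x | M < u x] = 0.
Proof.
move=> d0 s10 q1 qp hu.
have p1 : 1 < p by exact: (lt_trans q1 qp).
have p0 : 0 < p by exact: (lt_trans ltr01 p1).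
have [[/(LfunP_lty _ _ _ _ _ _ p0)[mu ui] _ _] _] := hu.
pose C := `|alpha| + `|beta|.
have C0 : 0 <= C by rewrite addr_ge0.
pose M k := fine (lebesgue_rV d [set x | k < u x]).
(* At levels [k <= 0] the measure may be infinite, and [fine] would send it to 0. *)
have ME k : 0 < k -> lebesgue_rV d [set x | k < u x] = (M k)%:E.
  move=> k0; rewrite fineK// ge0_fin_numE//.
  exact: (measure_superlevel_lty _ _ _ _ _ p).
(* [kappa] is the Faber-Krahn constant at radius 1; [D] combines the constant [C] of the energy
   estimate with the [2 ^ p] of [integral_superlevel_le]. *)
have [|||||K [th [K1 th0 th1 hM]]] := geometric_decay R d s1 p
  (faber_krahn_const d s1 p 1) (C * 2 `^ p) M d0 s10 p0.
- exact: faber_krahn_const_gt0.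
- by rewrite mulr_ge0 ?powR_ge0.
- by move=> k; exact: fine_ge0.
- by move=> eta; exact: (measure_superlevel_small _ _ _ _ _ p mu p0 ui _ (ltW p1)).
- move=> k rho delta k1 rho0 delta0 Mk.
  have k0 : 0 < k by exact: lt_le_trans k1.
  rewrite -faber_krahn_constE// => hc.
  apply: (superlevel_decay _ _ _ _ _ _ mu p0 ui _ C) => //; first exact: ltW.
  apply: le_trans (energy_trunc_le _ _ _ _ _ _ _ _ _ _ _ q1 qp k1 hu).
  apply: faber_krahn => //; first exact: measurable_trunc.
  by rewrite trunc_neq0 ME// lee_fin.
have K0 : 0 < K by exact: lt_le_trans K1.
exists (K * 2); apply/eqP; rewrite ME ?mulr_gt0// eqe eq_le fine_ge0// andbT.
have MK0 : 0 <= M K by exact: fine_ge0.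
(* All levels [K (2 - 2 ^ -j)] lie below [2 K], so their geometric bounds apply at [2 K] for every
   [j]. *)
suff h j : M (K * 2) <= th ^+ j * M K.
  have : (fun j => th ^+ j * M K) @ \oo --> 0 * M K.
    by apply: cvgMl; apply: cvg_expr; rewrite ger0_norm ?ltW.
  rewrite mul0r => cvg0; rewrite -(cvg_lim _ cvg0)//.
  by apply: limr_ge; [apply/cvg_ex; exists 0|apply: nearW].
apply: le_trans (hM j).
have hj : 0 < 2^-1 ^+ j :> R by rewrite exprn_gt0// invr_gt0.
have hj1 : 2^-1 ^+ j <= 1 :> R by rewrite exprn_ile1 ?invr_ge0//; lra.
have Kj : K * (2 - 2^-1 ^+ j) <= K * 2 by rewrite ler_wpM2l ?(ltW K0)//; lra.
have Kj0 : 0 < K * (2 - 2^-1 ^+ j) by rewrite mulr_gt0//; lra.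
rewrite -lee_fin -!ME//; last exact: mulr_gt0.
apply: le_measure; rewrite ?inE.
- exact: measurable_superlevel.
- exact: measurable_superlevel.
- by move=> x /=; exact: le_lt_trans.
Qed.

Theorem theorem4p1 (R : realType) (d : nat) (s1 s2 p q alpha beta : R)
    (Omega : set 'rV[R]_d) (u : 'rV[R]_d -> R)
    (hs2 : 0 < s2) (hs21 : s2 < s1) (hs1 : s1 < 1)
    (hq : 1 < q) (hqp : q < p)
    (hOmega_open : open Omega) (hOmega_bounded : bounded_set Omega)
    (hu : weak_solution s1 s2 p q alpha beta Omega u)
    (hu_ge0 : {ae lebesgue_rV d, forall x, 0 <= u x}) :
  u \in Lfun (lebesgue_rV d) +oo%E.
Proof.
have p0 : 0 < p by exact: (lt_trans ltr01 (lt_trans hq hqp)).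
have [[/(LfunP_lty _ _ _ _ _ _ p0)[mu _] _ _] _] := hu.
(* In dimension 0 the space is a single point and [|u 0|] is a bound. *)
case: (posnP d) => [d0|d0].
  subst d; apply: (ae_bounded_Lfun_oo _ _ _ _ `|u 0|) => //.
  by apply: aeW => x; rewrite (_ : x = 0)//; apply/rowP; case.
have [M uM] := superlevel_null _ _ _ _ _ _ _ _ _ _ d0 (lt_trans hs2 hs21) hq hqp hu.
apply: (ae_bounded_Lfun_oo _ _ _ _ M) => //.
have uM' : {ae lebesgue_rV d, forall x, u x <= M}.
  exists [set x | M < u x]; split => //; first exact: measurable_superlevel.
  by move=> x /= /negP; rewrite -ltNge.
(* Nonnegativity turns the upper bound into a bound on [|u|]. *)
by apply: filterS2 hu_ge0 uM' => x ux0 uxM; rewrite ger0_norm.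
Qed.
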